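(* Let $\mu\in\mathbb{C}$ with $\mu\neq 0$ and $|\mu|\leq 1$, and let $\Phi(z)=\mu z$ and $\Psi(z)=\frac{1}{\mu}z$ for $z\in\mathbb{C}$. Then $C_\Phi:H_E(\xi)\to H_E(\mu\xi)$ is invertible with inverse $C_\Psi:H_E(\mu\xi)\to H_E(\xi)$.
   Context: Let $\xi=(\xi_n)_{n\ge 0}$ be a sequence of positive real numbers with $\lim_{n\to\infty}\xi_n^{1/n}=\infty$. $H_E(\xi)$ is the Hilbert space of entire functions $f(z)=\sum_{n=0}^\infty a_n z^n$ with $\|f\|^2=\sum_{n=0}^\infty |a_n|^2\xi_n^2<\infty$. For $\mu\ne 0$, $\mu\xi$ denotes the sequence $\big(\frac{1}{|\mu|^n}\xi_n\big)_{n\ge 0}$ (which also satisfies the limit condition), so $H_E(\mu\xi)$ is the space of entire functions $f(z)=\sum_{n=0}^\infty b_nz^n$ with $\|f\|^2=\sum_{n=0}^\infty|b_n|^2\frac{1}{|\mu|^{2n}}\xi_n^2<\infty$. For an entire function $\Phi$, the composition operator is $C_\Phi f=f\circ\Phi$. *)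

(* Defs.v *)
From Stdlib Require Import Reals Lra Lia.
From Stdlib Require Import ClassicalEpsilon FunctionalExtensionality ProofIrrelevance.
From Coquelicot Require Import Coquelicot.

Open Scope R_scope.

Record weight : Type := Weight {
  weight_seq :> nat -> R;
  weight_pos : forall n, 0 < weight_seq n;
  (* The term n = 0, where [/ INR 0] is a junk value, does not affect the limit. *)
  weight_lim : is_lim_seq (fun n => Rpower (weight_seq n) (/ INR n)) p_infty
}.

Lemma scale_weight_pos (mu : C) (mu_neq0 : mu <> 0%C) (xi : weight) (n : nat) :
  0 < 1 / Cmod mu ^ n * xi n.
Proof.
apply Rmult_lt_0_compat; [|apply weight_pos].
apply Rdiv_lt_0_compat; [lra|apply pow_lt, Cmod_gt_0, mu_neq0].
Qed.

Lemma scale_weight_lim (mu : C) (mu_neq0 : mu <> 0%C) (xi : weight) :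
  is_lim_seq (fun n => Rpower (1 / Cmod mu ^ n * xi n) (/ INR n)) p_infty.
Proof.
assert (hmu : 0 < Cmod mu) by now apply Cmod_gt_0.
apply is_lim_seq_ext_loc with (fun n => / Cmod mu * Rpower (xi n) (/ INR n)).
- exists 1%nat; intros n hn.
  assert (hn0 : INR n <> 0) by (apply not_0_INR; lia).
  rewrite <- Rpower_mult_distr;
    [|apply Rdiv_lt_0_compat; [lra|now apply pow_lt]|apply weight_pos].
  f_equal; unfold Rdiv; rewrite Rmult_1_l, <- pow_inv.
  rewrite <- Rpower_pow by now apply Rinv_0_lt_compat.
  rewrite Rpower_mult, Rinv_r, Rpower_1; auto.
  now apply Rinv_0_lt_compat.
- replace p_infty with (Rbar_mult (/ Cmod mu) p_infty).
  + apply is_lim_seq_scal_l, weight_lim.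
  + apply Rinv_0_lt_compat in hmu; simpl.
    destruct (Rle_dec 0 (/ Cmod mu)) as [h|h]; [|lra].
    destruct (Rle_lt_or_eq_dec 0 (/ Cmod mu) h); [reflexivity|lra].
Qed.

Definition scale_weight (mu : C) (mu_neq0 : mu <> 0%C) (xi : weight) : weight :=
  Weight (fun n => 1 / Cmod mu ^ n * xi n)
    (scale_weight_pos mu mu_neq0 xi) (scale_weight_lim mu mu_neq0 xi).

Definition entire (f : C -> C) : Prop :=
  forall z : C, ex_derive (K := C_AbsRing) (V := C_NormedModule) f z.

Definition expansion (f : C -> C) (a : nat -> C) : Prop :=
  forall z : C, is_pseries (K := C_AbsRing) (V := C_NormedModule) a z (f z).

(* Meaningful when [f] has an expansion, which is then unique: see
   [expansion_unique] and [taylor_eq]. *)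
Definition taylor (f : C -> C) : nat -> C :=
  epsilon (inhabits (fun _ : nat => RtoC 0)) (expansion f).

Definition in_HE (xi : weight) (f : C -> C) : Prop :=
  entire f /\
  exists a : nat -> C,
    expansion f a /\ ex_series (fun n => Cmod (a n) ^ 2 * xi n ^ 2).

Record HE (xi : weight) : Type := mkHE {
  HE_fun :> C -> C;
  HE_prop : in_HE xi HE_fun
}.
Arguments mkHE {xi} _ _.
Arguments HE_fun {xi} _ _.
Arguments HE_prop {xi} _.

Definition HE_norm {xi : weight} (f : HE xi) : R :=
  sqrt (Series (fun n => Cmod (taylor f n) ^ 2 * xi n ^ 2)).

Lemma pow_n_RtoC (x : R) (n : nat) :
  @pow_n C_AbsRing (RtoC x) n = RtoC (x ^ n).
Proof.
induction n as [|n IH]; [reflexivity|].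
simpl; rewrite IH; symmetry; apply RtoC_mult.
Qed.

Lemma sum_n_Re (u : nat -> C) (n : nat) :
  fst (@sum_n C_NormedModule u n) = sum_n (fun k => fst (u k)) n.
Proof.
induction n as [|n IH].
- now rewrite !sum_O.
- rewrite !sum_Sn, <- IH; reflexivity.
Qed.

Lemma sum_n_Im (u : nat -> C) (n : nat) :
  snd (@sum_n C_NormedModule u n) = sum_n (fun k => snd (u k)) n.
Proof.
induction n as [|n IH].
- now rewrite !sum_O.
- rewrite !sum_Sn, <- IH; reflexivity.
Qed.

Lemma pseries_R_eq0 (b : nat -> R) :
  (forall x : R, is_series (fun k => b k * x ^ k) 0) -> forall n, b n = 0.
Proof.
intros H n.
assert (HP : forall x, PSeries b x = 0).
{ intros x; unfold PSeries; apply is_series_unique, H. }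
assert (HP0 : forall x, PSeries (fun _ => 0) x = 0).
{ intros x; apply PSeries_const_0. }
apply (PSeries_ext_recip b (fun _ => 0)).
- destruct (Rbar_lt_dec 0 (CV_radius b)) as [h|h]; [exact h|exfalso].
  apply (CV_disk_outside b 1).
  + apply Rbar_not_lt_le in h.
    apply Rbar_le_lt_trans with (1 := h); simpl; rewrite Rabs_R1; lra.
  + apply ex_series_lim_0; exists 0; apply H.
- rewrite CV_radius_const_0; exact I.
- apply filter_forall; intros x; now rewrite HP, HP0.
Qed.

Lemma expansion_zero_unique (c : nat -> C) :
  expansion (fun _ => 0%C) c -> forall n, c n = 0%C.
Proof.
intros H.
assert (Hs : forall x : R, is_series (V := C_NormedModule)
  (fun k => (RtoC (x ^ k) * c k)%C) (RtoC 0)).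
{ intros x; apply is_series_ext with (2 := H (RtoC x)).
  intros k; now rewrite pow_n_RtoC. }
intros n; apply injective_projections; simpl.
- apply (pseries_R_eq0 (fun k => fst (c k))); intros x.
  unfold is_series; apply filterlim_ext with
    (fun n => fst (@sum_n C_NormedModule (fun k => (RtoC (x ^ k) * c k)%C) n)).
  + intros m; rewrite sum_n_Re; apply sum_n_ext; intros k; simpl; ring.
  + exact (filterlim_comp _ _ _ _ fst _ _ _ (Hs x) (continuous_fst 0 0)).
- apply (pseries_R_eq0 (fun k => snd (c k))); intros x.
  unfold is_series; apply filterlim_ext with
    (fun n => snd (@sum_n C_NormedModule (fun k => (RtoC (x ^ k) * c k)%C) n)).
  + intros m; rewrite sum_n_Im; apply sum_n_ext; intros k; simpl; ring.
  + exact (filterlim_comp _ _ _ _ snd _ _ _ (Hs x) (continuous_snd 0 0)).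
Qed.

Lemma expansion_plus (f g : C -> C) (a b : nat -> C) :
  expansion f a -> expansion g b ->
  expansion (fun z => (f z + g z)%C) (fun n => (a n + b n)%C).
Proof. intros Hf Hg z; exact (is_pseries_plus _ _ _ _ _ (Hf z) (Hg z)). Qed.

Lemma expansion_scal (k : C) (f : C -> C) (a : nat -> C) :
  expansion f a -> expansion (fun z => (k * f z)%C) (fun n => (k * a n)%C).
Proof.
intros Hf z; exact (is_pseries_scal k _ _ _ (Cmult_comm z k) (Hf z)).
Qed.

Lemma expansion_unique (f : C -> C) (a b : nat -> C) :
  expansion f a -> expansion f b -> forall n, a n = b n.
Proof.
intros Ha Hb n.
assert (H : expansion (fun _ => 0%C) (fun n => (a n + - (1) * b n)%C)).
{ intros z.
  assert (E : (f z + - (1) * f z)%C = RtoC 0) by ring.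
  exact (eq_ind _ (fun w : C => is_pseries (K := C_AbsRing)
    (V := C_NormedModule) _ z w)
    (expansion_plus _ _ _ _ Ha (expansion_scal _ _ _ Hb) z) _ E). }
apply expansion_zero_unique with (n := n) in H.
replace (a n) with (a n + - (1) * b n + b n)%C by ring.
rewrite H; ring.
Qed.

Lemma taylor_eq (f : C -> C) (a : nat -> C) :
  expansion f a -> forall n, taylor f n = a n.
Proof.
intros Ha; apply expansion_unique with f; [|exact Ha].
unfold taylor; apply epsilon_spec; now exists a.
Qed.

Lemma HE_expansion {xi : weight} (f : HE xi) : expansion f (taylor f).
Proof.
destruct (HE_prop f) as [_ [a [Ha _]]]; unfold taylor; apply epsilon_spec; now exists a.
Qed.

Lemma HE_summable {xi : weight} (f : HE xi) :
  ex_series (fun n => Cmod (taylor f n) ^ 2 * xi n ^ 2).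
Proof.
destruct (HE_prop f) as [_ [a [Ha Hs]]].
apply ex_series_ext with (2 := Hs); intros n; now rewrite (taylor_eq f a).
Qed.

Lemma HE_ext {xi : weight} (f g : HE xi) : (forall z, f z = g z) -> f = g.
Proof.
destruct f as [f hf], g as [g hg]; simpl; intros H.
apply functional_extensionality in H; subst g.
f_equal; apply proof_irrelevance.
Qed.

Lemma Series_ge0 (u : nat -> R) :
  (forall n, 0 <= u n) -> ex_series u -> 0 <= Series u.
Proof.
intros Hu Hs.
replace 0 with (Series (fun _ => 0)).
- apply Series_le; [intros n; split; [lra|apply Hu]|exact Hs].
- apply is_series_unique; apply filterlim_ext with (fun _ : nat => 0).
  + intros n; rewrite sum_n_const; ring.
  + apply filterlim_const.
Qed.

Lemma Series_eq0 (u : nat -> R) :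
  (forall n, 0 <= u n) -> ex_series u -> Series u = 0 -> forall n, u n = 0.
Proof.
intros Hu Hs H0 n.
assert (Hp : 0 <= Series (fun k => u (S n + k)%nat)).
{ apply Series_ge0; [intros; apply Hu|now apply (ex_series_incr_n u (S n))]. }
rewrite (Series_incr_n u (S n)) in H0; [|lia|exact Hs].
simpl in H0.
assert (Hq : forall m, 0 <= sum_f_R0 u m) by (intros; apply cond_pos_sum, Hu).
pose proof (Hu n).
specialize (Hq (pred n)).
destruct n as [|n]; simpl in H0, Hq, Hp; lra.
Qed.

Lemma l2_plus (u v : nat -> R) :
  ex_series (fun n => u n ^ 2) -> ex_series (fun n => v n ^ 2) ->
  ex_series (fun n => (u n + v n) ^ 2) /\
  sqrt (Series (fun n => (u n + v n) ^ 2)) <=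
    sqrt (Series (fun n => u n ^ 2)) + sqrt (Series (fun n => v n ^ 2)).
Proof.
intros Hu Hv.
assert (Hdom : forall s t, ex_series (fun n => s * u n ^ 2 + t * v n ^ 2)).
{ intros s t; apply (ex_series_plus (V := R_NormedModule));
    apply (ex_series_scal (V := R_NormedModule)); assumption. }
assert (Hs : ex_series (fun n => (u n + v n) ^ 2)).
{ apply (ex_series_le (V := R_CompleteNormedModule)) with (2 := Hdom 2 2).
  intros n; change (norm ?x) with (Rabs x).
  rewrite Rabs_pos_eq by apply pow2_ge_0; pose proof (pow2_ge_0 (u n - v n)); nra. }
split; [exact Hs|].
assert (HA : 0 <= Series (fun n => u n ^ 2))
  by (apply Series_ge0; [intros; apply pow2_ge_0|exact Hu]).
assert (HB : 0 <= Series (fun n => v n ^ 2))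
  by (apply Series_ge0; [intros; apply pow2_ge_0|exact Hv]).
set (A := sqrt (Series (fun n => u n ^ 2))).
set (B := sqrt (Series (fun n => v n ^ 2))).
assert (A0 : 0 <= A) by apply sqrt_pos.
assert (B0 : 0 <= B) by apply sqrt_pos.
apply le_epsilon; intros e he.
set (a := A + e / 2); set (b := B + e / 2).
assert (ha : 0 < a) by (unfold a; lra).
assert (hb : 0 < b) by (unfold b; lra).
replace (A + B + e) with (a + b) by (unfold a, b; lra).
rewrite <- (sqrt_pow2 (a + b)) by lra.
apply sqrt_le_1_alt.
apply Rle_trans with
  (Series (fun n => (a + b) / a * u n ^ 2 + (a + b) / b * v n ^ 2)).
- apply Series_le; [|apply Hdom].
  intros n; split; [apply pow2_ge_0|].
  apply Rminus_le_0.
  replace (_ - _) with ((b * u n - a * v n) ^ 2 / (a * b)) by (field; lra).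
  apply Rdiv_le_0_compat; [apply pow2_ge_0|nra].
- rewrite Series_plus;
    [|apply (ex_series_scal (V := R_NormedModule)); exact Hu
     |apply (ex_series_scal (V := R_NormedModule)); exact Hv].
  rewrite !Series_scal_l.
  rewrite <- (pow2_sqrt _ HA), <- (pow2_sqrt _ HB); fold A B.
  replace ((a + b) ^ 2) with ((a + b) / a * a ^ 2 + (a + b) / b * b ^ 2)
    by (field; lra).
  apply Rplus_le_compat; apply Rmult_le_compat_l;
    try (apply Rdiv_le_0_compat; lra);
    apply pow_incr; unfold a, b; lra.
Qed.

Lemma weighted_plus (xi : weight) (a b : nat -> C) :
  ex_series (fun n => Cmod (a n) ^ 2 * xi n ^ 2) ->
  ex_series (fun n => Cmod (b n) ^ 2 * xi n ^ 2) ->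
  ex_series (fun n => Cmod (a n + b n) ^ 2 * xi n ^ 2) /\
  sqrt (Series (fun n => Cmod (a n + b n) ^ 2 * xi n ^ 2)) <=
    sqrt (Series (fun n => Cmod (a n) ^ 2 * xi n ^ 2)) +
    sqrt (Series (fun n => Cmod (b n) ^ 2 * xi n ^ 2)).
Proof.
intros Ha Hb.
assert (E : forall c : nat -> C, forall n,
  Cmod (c n) ^ 2 * xi n ^ 2 = (Cmod (c n) * xi n) ^ 2) by (intros; ring).
rewrite (Series_ext _ _ (E a)), (Series_ext _ _ (E b)).
apply (ex_series_ext _ _ (E a)) in Ha.
apply (ex_series_ext _ _ (E b)) in Hb.
destruct (l2_plus _ _ Ha Hb) as [Hs Hle].
assert (Hn : forall n, 0 <= Cmod (a n + b n) ^ 2 * xi n ^ 2 <=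
  (Cmod (a n) * xi n + Cmod (b n) * xi n) ^ 2).
{ intros n; split.
  - apply Rmult_le_pos; apply pow2_ge_0.
  - replace (_ * _) with ((Cmod (a n + b n) * xi n) ^ 2) by ring.
    pose proof (weight_pos xi n).
    apply pow_incr; split.
    + apply Rmult_le_pos; [apply Cmod_ge_0|lra].
    + rewrite <- Rmult_plus_distr_r.
      apply Rmult_le_compat_r; [lra|apply Cmod_triangle]. }
split.
- apply (ex_series_le (V := R_CompleteNormedModule)) with (2 := Hs).
  intros n; change (norm ?x) with (Rabs x).
  rewrite Rabs_pos_eq; apply Hn.
- apply Rle_trans with (2 := Hle), sqrt_le_1_alt, Series_le; auto.
Qed.

Lemma weighted_scal (xi : weight) (k : C) (a : nat -> C) (n : nat) :
  Cmod (k * a n) ^ 2 * xi n ^ 2 = Cmod k ^ 2 * (Cmod (a n) ^ 2 * xi n ^ 2).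
Proof. rewrite Cmod_mult; ring. Qed.

Lemma in_HE_zero (xi : weight) : in_HE xi (fun _ => 0%C).
Proof.
split; [intros z; apply ex_derive_const|].
exists (fun _ => 0%C); split.
- intros z; unfold is_pseries, is_series.
  apply filterlim_ext with (fun _ : nat => RtoC 0); [|apply filterlim_const].
  intros n; induction n as [|n IH].
  + rewrite sum_O; symmetry; apply (scal_zero_r (V := C_NormedModule)).
  + rewrite sum_Sn, <- IH.
    rewrite (scal_zero_r (V := C_NormedModule)).
    symmetry; apply (plus_zero_r (G := C_NormedModule)).
- apply ex_series_ext with (fun _ : nat => 0).
  + intros n; change (0 = Cmod 0 ^ 2 * xi n ^ 2); rewrite Cmod_0; ring.
  + exists 0; apply filterlim_ext with (fun _ : nat => 0).
    * intros n; rewrite sum_n_const; ring.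
    * apply filterlim_const.
Qed.

Lemma in_HE_plus (xi : weight) (f g : C -> C) :
  in_HE xi f -> in_HE xi g -> in_HE xi (fun z => (f z + g z)%C).
Proof.
intros [Df [a [Ha Hsa]]] [Dg [b [Hb Hsb]]]; split.
- intros z; exact (ex_derive_plus _ _ _ (Df z) (Dg z)).
- exists (fun n => (a n + b n)%C); split.
  + now apply expansion_plus.
  + now apply weighted_plus.
Qed.

Lemma in_HE_scal (xi : weight) (k : C) (f : C -> C) :
  in_HE xi f -> in_HE xi (fun z => (k * f z)%C).
Proof.
intros [Df [a [Ha Hsa]]]; split.
- intros z; destruct (Df z) as [l Hl].
  exists (scal (V := C_NormedModule) k l).
  eapply filterdiff_ext_lin.
  + apply (filterdiff_scal_r_fct (U := AbsRing_NormedModule C_AbsRing) (V := C_NormedModule) k f);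
      [exact Cmult_comm|exact Hl].
  + intros y; change (k * (y * l) = y * (k * l))%C; ring.
- exists (fun n => (k * a n)%C); split.
  + now apply expansion_scal.
  + apply ex_series_ext with (fun n => Cmod k ^ 2 * (Cmod (a n) ^ 2 * xi n ^ 2)).
    * intros n; symmetry; apply weighted_scal.
    * now apply (ex_series_scal (V := R_NormedModule)).
Qed.

Section HE_structures.

Variable xi : weight.
Implicit Types f g h : HE xi.

Definition HE_zero : HE xi := mkHE _ (in_HE_zero xi).
Definition HE_plus f g : HE xi :=
  mkHE _ (in_HE_plus xi f g (HE_prop f) (HE_prop g)).
Definition HE_scal (k : C) f : HE xi :=
  mkHE _ (in_HE_scal xi k f (HE_prop f)).
Definition HE_opp f : HE xi := HE_scal (- (1))%C f.

Lemma HE_plus_comm f g : HE_plus f g = HE_plus g f.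
Proof. apply HE_ext; intros z; apply Cplus_comm. Qed.

Lemma HE_plus_assoc f g h : HE_plus f (HE_plus g h) = HE_plus (HE_plus f g) h.
Proof. apply HE_ext; intros z; apply Cplus_assoc. Qed.

Lemma HE_plus_zero_r f : HE_plus f HE_zero = f.
Proof. apply HE_ext; intros z; apply Cplus_0_r. Qed.

Lemma HE_plus_opp_r f : HE_plus f (HE_opp f) = HE_zero.
Proof. apply HE_ext; intros z; simpl; ring. Qed.

Definition HE_AbelianMonoid_mixin :=
  AbelianMonoid.Mixin (HE xi) HE_plus HE_zero
    HE_plus_comm HE_plus_assoc HE_plus_zero_r.
Canonical HE_AbelianMonoid :=
  AbelianMonoid.Pack (HE xi) HE_AbelianMonoid_mixin (HE xi).

Definition HE_AbelianGroup_mixin :=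
  AbelianGroup.Mixin HE_AbelianMonoid HE_opp HE_plus_opp_r.
Canonical HE_AbelianGroup :=
  AbelianGroup.Pack (HE xi)
    (AbelianGroup.Class (HE xi) HE_AbelianMonoid_mixin HE_AbelianGroup_mixin)
    (HE xi).

Lemma HE_scal_assoc (k l : C) f :
  HE_scal k (HE_scal l f) = HE_scal (k * l)%C f.
Proof. apply HE_ext; intros z; simpl; ring. Qed.

Lemma HE_scal_one f : HE_scal 1%C f = f.
Proof. apply HE_ext; intros z; simpl; ring. Qed.

Lemma HE_scal_distr_l (k : C) f g :
  HE_scal k (HE_plus f g) = HE_plus (HE_scal k f) (HE_scal k g).
Proof. apply HE_ext; intros z; simpl; ring. Qed.

Lemma HE_scal_distr_r (k l : C) f :
  HE_scal (k + l)%C f = HE_plus (HE_scal k f) (HE_scal l f).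
Proof. apply HE_ext; intros z; simpl; ring. Qed.

Definition HE_ModuleSpace_mixin :=
  ModuleSpace.Mixin C_Ring HE_AbelianGroup HE_scal
    HE_scal_assoc HE_scal_one HE_scal_distr_l HE_scal_distr_r.
Canonical HE_ModuleSpace :=
  ModuleSpace.Pack C_Ring (HE xi)
    (ModuleSpace.Class C_Ring (HE xi)
       (AbelianGroup.class HE_AbelianGroup) HE_ModuleSpace_mixin)
    (HE xi).

Lemma HE_norm_triangle f g : HE_norm (HE_plus f g) <= HE_norm f + HE_norm g.
Proof.
unfold HE_norm.
rewrite (Series_ext _ (fun n => Cmod (taylor f n + taylor g n) ^ 2 * xi n ^ 2)).
- apply weighted_plus; apply HE_summable.
- intros n; f_equal; f_equal; f_equal.
  apply (taylor_eq (HE_plus f g) (fun m => (taylor f m + taylor g m)%C)).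
  apply expansion_plus; apply HE_expansion.
Qed.

Lemma HE_norm_scal (k : C) f : HE_norm (HE_scal k f) = Cmod k * HE_norm f.
Proof.
unfold HE_norm.
rewrite (Series_ext _
  (fun n => Cmod k ^ 2 * (Cmod (taylor f n) ^ 2 * xi n ^ 2))).
- rewrite Series_scal_l, sqrt_mult_alt by apply pow2_ge_0.
  rewrite sqrt_pow2; [reflexivity|apply Cmod_ge_0].
- intros n; rewrite <- weighted_scal; f_equal; f_equal; f_equal.
  apply (taylor_eq (HE_scal k f) (fun m => (k * taylor f m)%C)), expansion_scal, HE_expansion.
Qed.

Lemma HE_norm_eq0 f : HE_norm f = 0 -> f = HE_zero.
Proof.
assert (Hpos : forall n, 0 <= Cmod (taylor f n) ^ 2 * xi n ^ 2).
{ intros n; apply Rmult_le_pos; apply pow2_ge_0. }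
intros H; apply sqrt_eq_0 in H; [|apply Series_ge0; [exact Hpos|apply HE_summable]].
assert (Ht : forall n, taylor f n = 0%C).
{ intros n; apply Cmod_eq_0.
  pose proof (Series_eq0 _ Hpos (HE_summable f) H n) as H0.
  pose proof (weight_pos xi n).
  apply Rmult_integral in H0; destruct H0 as [H0|H0].
  - apply Rsqr_0_uniq; unfold Rsqr; lra.
  - exfalso; assert (0 < xi n ^ 2) by (apply pow_lt; lra); lra. }
apply HE_ext; intros z.
pose proof (HE_expansion f z) as Hf.
pose proof (expansion_scal 0 f _ (HE_expansion f) z) as H0.
assert (E : f z = (0 * f z)%C).
{ apply (filterlim_locally_unique (F := eventually) (V := C_NormedModule)
    _ _ _ Hf).
  apply filterlim_ext with (2 := H0); intros n; apply sum_n_ext; intros k.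
  f_equal; rewrite Ht; ring. }
rewrite E; simpl; ring.
Qed.

Lemma HE_norm_opp f : HE_norm (HE_opp f) = HE_norm f.
Proof. unfold HE_opp; rewrite HE_norm_scal, Cmod_m1; ring. Qed.

Definition HE_ball f (eps : R) g : Prop := HE_norm (minus g f) < eps.

Lemma HE_ball_center f (eps : posreal) : HE_ball f eps f.
Proof.
unfold HE_ball; replace (minus f f) with (HE_scal 0%C f).
- rewrite HE_norm_scal, Cmod_0, Rmult_0_l; apply cond_pos.
- apply HE_ext; intros z; simpl; ring.
Qed.

Lemma HE_ball_sym f g (eps : R) : HE_ball f eps g -> HE_ball g eps f.
Proof.
unfold HE_ball; rewrite <- (HE_norm_opp (minus g f)).
intros H; replace (minus f g) with (HE_opp (minus g f)); [exact H|].
apply HE_ext; intros z; simpl; ring.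
Qed.

Lemma HE_ball_triangle f g h (e1 e2 : R) :
  HE_ball f e1 g -> HE_ball g e2 h -> HE_ball f (e1 + e2) h.
Proof.
unfold HE_ball; intros H1 H2.
replace (minus h f) with (HE_plus (minus g f) (minus h g)).
- pose proof (HE_norm_triangle (minus g f) (minus h g)); lra.
- apply HE_ext; intros z; simpl; ring.
Qed.

Definition HE_UniformSpace_mixin :=
  UniformSpace.Mixin (HE xi) HE_zero HE_ball
    HE_ball_center HE_ball_sym HE_ball_triangle.
Canonical HE_UniformSpace :=
  UniformSpace.Pack (HE xi) HE_UniformSpace_mixin (HE xi).

Canonical HE_NormedModuleAux :=
  NormedModuleAux.Pack C_AbsRing (HE xi)
    (NormedModuleAux.Class C_AbsRing (HE xi)
       (ModuleSpace.class C_Ring HE_ModuleSpace) HE_UniformSpace_mixin)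
    (HE xi).

Lemma HE_norm_scal_le (k : C) f : HE_norm (HE_scal k f) <= Cmod k * HE_norm f.
Proof. rewrite HE_norm_scal; apply Rle_refl. Qed.

Lemma HE_norm_ball f g (eps : R) : HE_norm (minus g f) < eps -> HE_ball f eps g.
Proof. exact (fun H => H). Qed.

Lemma HE_ball_norm f g (eps : posreal) :
  HE_ball f eps g -> HE_norm (minus g f) < 1 * eps.
Proof. now rewrite Rmult_1_l. Qed.

Definition HE_NormedModule_mixin :=
  NormedModule.Mixin C_AbsRing HE_NormedModuleAux HE_norm 1
    HE_norm_triangle HE_norm_scal_le HE_norm_ball HE_ball_norm HE_norm_eq0.
Canonical HE_NormedModule :=
  NormedModule.Pack C_AbsRing (HE xi)
    (NormedModule.Class C_AbsRing (HE xi)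
       (NormedModuleAux.class C_AbsRing HE_NormedModuleAux)
       HE_NormedModule_mixin)
    (HE xi).

End HE_structures.

(* An operator with this property is unique, by [HE_ext]; its existence is the
   assertion that composition with [Phi] maps [HE xi] into [HE eta]. *)
Definition is_composition_operator {xi eta : weight} (Phi : C -> C)
  (T : HE xi -> HE eta) : Prop :=
  forall (f : HE xi) (z : C), T f z = f (Phi z).

(* [is_linear] includes boundedness. *)
Definition invertible_with_inverse {K : AbsRing} {U V : NormedModule K}
  (T : U -> V) (S : V -> U) : Prop :=
  is_linear T /\ is_linear S /\
  (forall u : U, S (T u) = u) /\ (forall v : V, T (S v) = v).

(* Main.v *)
(* Composing f = sum a_n z^n with z |-> c z multiplies a_n by c^n, so the
   composition is an isometry whenever the weights satisfy |c|^n eta_n = xi_n;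
   this applies to c = mu and, in the opposite direction, to c = 1 / mu. *)
Require Import Defs.
From Stdlib Require Import Reals.
From Coquelicot Require Import Coquelicot.

Lemma pow_n_Cmult (c z : C) (n : nat) :
  @pow_n C_AbsRing (c * z)%C n =
  (@pow_n C_AbsRing c n * @pow_n C_AbsRing z n)%C.
Proof.
induction n as [|n IH]; simpl.
- symmetry; apply Cmult_1_l.
- rewrite IH.
  (* The abstract [mult] inside [pow_n] is converted to complex multiplication so that [ring]
     applies. *)
  change (c * z * (@pow_n C_AbsRing c n * @pow_n C_AbsRing z n) =
    c * @pow_n C_AbsRing c n * (z * @pow_n C_AbsRing z n))%C; ring.
Qed.

Lemma Cmod_pow_n (c : C) (n : nat) : Cmod (@pow_n C_AbsRing c n) = Cmod c ^ n.
Proof.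
induction n as [|n IH]; simpl.
- apply Cmod_1.
- rewrite <- IH; apply Cmod_mult.
Qed.

Lemma entire_comp_scale (c : C) (f : C -> C) :
  entire f -> entire (fun z => f (c * z)%C).
Proof.
intros Hf z.
apply (ex_derive_comp (K := C_AbsRing) (V := C_NormedModule) f
  (fun w : C_AbsRing => (c * w)%C)); [apply Hf|].
(* The factors are swapped so that [w] is the scalar and [c] the fixed vector, as [ex_derive_scal_l]
   expects. *)
apply (ex_derive_ext (K := C_AbsRing) (V := AbsRing_NormedModule C_AbsRing)
  (fun w => scal w c)).
- intros w; apply Cmult_comm.
- apply (ex_derive_scal_l (K := C_AbsRing)
    (V := AbsRing_NormedModule C_AbsRing) (fun w => w)), ex_derive_id.
Qed.

Lemma expansion_comp_scale (c : C) (f : C -> C) (a : nat -> C) :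
  expansion f a ->
  expansion (fun z => f (c * z)%C) (fun n => (@pow_n C_AbsRing c n * a n)%C).
Proof.
intros Hf z; apply is_series_ext with (2 := Hf (c * z)%C); intros n.
rewrite pow_n_Cmult.
change (@pow_n C_AbsRing c n * @pow_n C_AbsRing z n * a n =
  @pow_n C_AbsRing z n * (@pow_n C_AbsRing c n * a n))%C; ring.
Qed.

Section CompositionWithScaling.

Variables (xi eta : weight) (c : C).
Hypothesis weight_eq : forall n, Cmod c ^ n * eta n = xi n.

(** Since |c^n| = |c|^n, the factor is absorbed by [weight_eq]. This termwise identity gives both
    membership in [HE eta] and the isometry. *)
Lemma weighted_comp_scale (a : nat -> C) (n : nat) :
  Cmod (@pow_n C_AbsRing c n * a n)%C ^ 2 * eta n ^ 2 =
  Cmod (a n) ^ 2 * xi n ^ 2.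
Proof. rewrite Cmod_mult, Cmod_pow_n, <- weight_eq; ring. Qed.

Lemma in_HE_comp_scale (f : C -> C) :
  in_HE xi f -> in_HE eta (fun z => f (c * z)%C).
Proof.
intros [Df [a [Ha Hs]]]; split; [now apply entire_comp_scale|].
exists (fun n => (@pow_n C_AbsRing c n * a n)%C); split.
- now apply expansion_comp_scale.
- apply ex_series_ext with (2 := Hs); intros n.
  symmetry; apply weighted_comp_scale.
Qed.

Definition comp_scale (f : HE xi) : HE eta :=
  mkHE _ (in_HE_comp_scale f (HE_prop f)).

Lemma HE_norm_comp_scale (f : HE xi) : HE_norm (comp_scale f) = HE_norm f.
Proof.
unfold HE_norm; f_equal; apply Series_ext; intros n.
rewrite <- weighted_comp_scale; f_equal; f_equal; f_equal.
(* [taylor] is chosen by [epsilon], so the coefficients of the image are identified by uniqueness of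
   the expansion. *)
apply (taylor_eq (comp_scale f)
  (fun m => (@pow_n C_AbsRing c m * taylor f m)%C)).
apply expansion_comp_scale, HE_expansion.
Qed.

Lemma is_linear_comp_scale : is_linear comp_scale.
Proof.
split.
- intros f g; now apply HE_ext.
- intros k f; now apply HE_ext.
(* The isometry gives the operator bound 1. *)
- exists 1; split; [apply Rlt_0_1|]; intros f.
  rewrite Rmult_1_l; apply Req_le, HE_norm_comp_scale.
Qed.

End CompositionWithScaling.

Theorem theorem4p5 (xi : weight) (mu : C) (mu_neq0 : mu <> 0%C)
    (mu_le1 : (Cmod mu <= 1)%R) :
  let Phi := fun z : C => (mu * z)%C in
  let Psi := fun z : C => (1 / mu * z)%C in
  exists (C_Phi : HE xi -> HE (scale_weight mu mu_neq0 xi))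
         (C_Psi : HE (scale_weight mu mu_neq0 xi) -> HE xi),
    is_composition_operator Phi C_Phi /\
    is_composition_operator Psi C_Psi /\
    invertible_with_inverse C_Phi C_Psi.
Proof.
intros Phi Psi.
set (eta := scale_weight mu mu_neq0 xi).
assert (Hpow : forall n, Cmod mu ^ n <> 0)
  by (intros n; apply pow_nonzero, Rgt_not_eq, Cmod_gt_0, mu_neq0).
assert (HPhi : forall n, Cmod mu ^ n * eta n = xi n)
  by (intros n; simpl; field; apply Hpow).
(* With the two weights exchanged and c = 1 / mu, the compatibility condition is the definition of
   [eta]. *)
assert (HPsi : forall n, Cmod (1 / mu)%C ^ n * xi n = eta n).
{ intros n; simpl; rewrite Cmod_div, Cmod_1 by exact mu_neq0.
  unfold Rdiv; now rewrite !Rmult_1_l, pow_inv. }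
exists (comp_scale xi eta mu HPhi), (comp_scale eta xi (1 / mu)%C HPsi).
(* Both composition identities hold by conversion. Only the two round trips remain, and each reduces
   to mu * (1 / mu) = 1 inside the argument of [f]. *)
repeat split; try apply is_linear_comp_scale.
- intros f; apply HE_ext; intros z; simpl; f_equal; now field.
- intros f; apply HE_ext; intros z; simpl; f_equal; now field.
Qed.
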